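(* Let $B\in\mathbb{H}^{r\times k}$ have full column rank and let $$B_{\rm new}=\begin{bmatrix} B \\ {a^*} \end{bmatrix},\qquad a\in\mathbb{H}^k.$$ Let $G=B^*B$, $c=G^{-1}a$, $d=1+a^*c$, and $s=Bc$. Then $d$ is a positive real number and $$B_{\rm new}^{\dagger}=\begin{bmatrix}B^{\dagger}-cd^{-1}s^* & cd^{-1}\end{bmatrix}.$$
   Context: $\mathbb{H}$ is the skew field of real quaternions; $M^*$ is the conjugate transpose of a quaternion matrix. Elements of $\mathbb{H}^k$ are column vectors. Full column rank means the columns are right-linearly independent over $\mathbb{H}$. For a quaternion matrix $M$ with full column rank, $M^\dagger=(M^*M)^{-1}M^*$ is its Moore–Penrose pseudoinverse. *)

(* Defs.v *)
From HB Require Import structures.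
From mathcomp Require Import all_boot all_order all_algebra.
From mathcomp Require Import ring lra.
From mathcomp Require Import boolp classical_sets reals.

Set Implicit Arguments.
Unset Strict Implicit.
Unset Printing Implicit Defensive.

Import Order.TTheory GRing.Theory Num.Theory.
Local Open Scope ring_scope.

Section Quaternion.
Variable R : realType.

(* [Quat a b c d] is a + b i + c j + d k. *)
Record quat := Quat { qre : R; qi : R; qj : R; qk : R }.

Definition prod_of_quat (x : quat) : R * R * R * R :=
  (qre x, qi x, qj x, qk x).

Definition quat_of_prod (p : R * R * R * R) : quat :=
  Quat p.1.1.1 p.1.1.2 p.1.2 p.2.

Lemma prod_of_quatK : cancel prod_of_quat quat_of_prod.
Proof. by case. Qed.

HB.instance Definition _ := Choice.copy quat (can_type prod_of_quatK).

Lemma quatP (x y : quat) :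
  qre x = qre y -> qi x = qi y -> qj x = qj y -> qk x = qk y -> x = y.
Proof. by case: x y => [? ? ? ?] [? ? ? ?] /= -> -> -> ->. Qed.

Definition addq (x y : quat) : quat :=
  Quat (qre x + qre y) (qi x + qi y) (qj x + qj y) (qk x + qk y).

Definition oppq (x : quat) : quat :=
  Quat (- qre x) (- qi x) (- qj x) (- qk x).

(* i^2 = j^2 = k^2 = ijk = -1, extended R-bilinearly. *)
Definition mulq (x y : quat) : quat :=
  Quat (qre x * qre y - qi x * qi y - qj x * qj y - qk x * qk y)
       (qre x * qi y + qi x * qre y + qj x * qk y - qk x * qj y)
       (qre x * qj y - qi x * qk y + qj x * qre y + qk x * qi y)
       (qre x * qk y + qi x * qj y - qj x * qi y + qk x * qre y).

Definition realq (t : R) : quat := Quat t 0 0 0.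

Definition conjq (x : quat) : quat :=
  Quat (qre x) (- qi x) (- qj x) (- qk x).

Definition normsq (x : quat) : R :=
  qre x ^+ 2 + qi x ^+ 2 + qj x ^+ 2 + qk x ^+ 2.

Definition invq (x : quat) : quat := mulq (conjq x) (realq (normsq x)^-1).

Fact addqA : associative addq.
Proof. by move=> x y z; apply: quatP => /=; ring. Qed.
Fact addqC : commutative addq.
Proof. by move=> x y; apply: quatP => /=; ring. Qed.
Fact add0q : left_id (realq 0) addq.
Proof. by move=> x; apply: quatP => /=; ring. Qed.
Fact addNq : left_inverse (realq 0) oppq addq.
Proof. by move=> x; apply: quatP => /=; ring. Qed.

HB.instance Definition _ := GRing.isZmodule.Build quat addqA addqC add0q addNq.

Fact mulqA : associative mulq.
Proof. by move=> x y z; apply: quatP => /=; ring. Qed.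
Fact mul1q : left_id (realq 1) mulq.
Proof. by move=> x; apply: quatP => /=; ring. Qed.
Fact mulq1 : right_id (realq 1) mulq.
Proof. by move=> x; apply: quatP => /=; ring. Qed.
Fact mulqDl : left_distributive mulq +%R.
Proof. by move=> x y z; apply: quatP => /=; ring. Qed.
Fact mulqDr : right_distributive mulq +%R.
Proof. by move=> x y z; apply: quatP => /=; ring. Qed.
Fact oneq_neq0 : realq 1 != 0.
Proof. by apply/eqP => -[] /eqP; rewrite oner_eq0. Qed.

HB.instance Definition _ :=
  GRing.Zmodule_isNzRing.Build quat mulqA mul1q mulq1 mulqDl mulqDr oneq_neq0.

Lemma normsq_ge0 (x : quat) : 0 <= normsq x.
Proof. by rewrite /normsq !addr_ge0 ?sqr_ge0. Qed.

Lemma normsq_eq0 (x : quat) : (normsq x == 0) = (x == 0).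
Proof.
apply/eqP/eqP => [|->]; last by rewrite /normsq /=; ring.
rewrite /normsq => x0; apply: quatP => /=; apply/eqP; rewrite -sqrf_eq0;
  apply/eqP/le_anti; rewrite sqr_ge0 andbT;
  have := sqr_ge0 (qre x); have := sqr_ge0 (qi x);
  have := sqr_ge0 (qj x); have := sqr_ge0 (qk x); lra.
Qed.

Fact mulVq : {in [pred x | x != 0], left_inverse 1 invq *%R}.
Proof.
move=> x; rewrite inE -normsq_eq0 /normsq => x0.
by apply: quatP; rewrite /= /normsq; field.
Qed.

Fact mulqV : {in [pred x | x != 0], right_inverse 1 invq *%R}.
Proof.
move=> x; rewrite inE -normsq_eq0 /normsq => x0.
by apply: quatP; rewrite /= /normsq; field.
Qed.

Fact unitqP (x y : quat) : y * x = 1 /\ x * y = 1 -> x != 0.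
Proof.
by case=> + _; apply: contraPneq => ->; rewrite mulr0; apply/eqP;
  rewrite eq_sym oner_neq0.
Qed.

Fact invq_out : {in [predC [pred x | x != 0]], invq =1 id}.
Proof. by move=> x; rewrite !inE negbK => /eqP ->; apply: quatP => /=; ring. Qed.

HB.instance Definition _ :=
  GRing.NzRing_hasMulInverse.Build quat mulVq mulqV unitqP invq_out.

Lemma conjqM (x y : quat) : conjq (x * y) = conjq y * conjq x.
Proof. by apply: quatP => /=; ring. Qed.

Lemma conjq_sum (I : finType) (F : I -> quat) :
  conjq (\sum_i F i) = \sum_i conjq (F i).
Proof.
apply: (big_morph conjq); last by apply: quatP => /=; ring.
by move=> x y; apply: quatP => /=; ring.
Qed.

Lemma conjq_mul (x : quat) : conjq x * x = realq (normsq x).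
Proof. by apply: quatP; rewrite /= /normsq; ring. Qed.

Lemma qre_sum (I : finType) (F : I -> quat) :
  qre (\sum_i F i) = \sum_i qre (F i).
Proof. by apply: (big_morph qre). Qed.

End Quaternion.

Section QuaternionMatrix.
Variable R : realType.
Local Notation H := (quat R).

Definition ctrmx m n (M : 'M[H]_(m, n)) : 'M[H]_(n, m) :=
  (map_mx (@conjq R) M)^T.

(* Right multiplication of a column v by a scalar x is [v *m x%:M]. *)
Definition full_col_rank m n (M : 'M[H]_(m, n)) : Prop :=
  forall x : 'I_n -> H,
    \sum_(j < n) col j M *m (x j)%:M = 0 -> forall j, x j = 0.

Definition is_invmx n (M W : 'M[H]_n) : Prop :=
  M *m W = 1%:M /\ W *m M = 1%:M.

(* [unitmx] and [invmx] need commutative coefficients; here the inverse is the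
   unique two-sided one when it exists, and 0 otherwise. *)
Definition qinvmx n (M : 'M[H]_n) : 'M[H]_n := xget 0 [set W | is_invmx M W].

Definition pinvmxq m n (M : 'M[H]_(m, n)) : 'M[H]_(n, m) :=
  qinvmx (ctrmx M *m M) *m ctrmx M.

Lemma is_invmx_unique n (M W W' : 'M[H]_n) :
  is_invmx M W -> is_invmx M W' -> W = W'.
Proof.
by move=> [_ WM] [MW' _]; rewrite -[W]mulmx1 -MW' mulmxA WM mul1mx.
Qed.

Lemma qinvmxP n (M W : 'M[H]_n) : is_invmx M W -> is_invmx M (qinvmx M).
Proof. by move=> MW; exact: (xgetI (P := [set W | is_invmx M W]) 0 MW). Qed.

Lemma full_col_rankP m n (M : 'M[H]_(m, n)) :
  full_col_rank M <-> forall v : 'cV[H]_n, M *m v = 0 -> v = 0.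
Proof.
have E (v : 'cV[H]_n) : \sum_(j < n) col j M *m (v j 0)%:M = M *m v.
  apply/matrixP => i j; rewrite summxE ord1 !mxE; apply: eq_bigr => l _.
  by rewrite !mxE big_ord1 !mxE eqxx mulr1n.
split=> [Mf v Mv|Mf x Mx j].
  by apply/matrixP => i j; rewrite ord1 mxE; apply: (Mf (fun j => v j 0)); rewrite E.
have /(congr1 (fun v : 'cV[H]_n => v j 0)) : \col_j x j = 0.
  apply: Mf; rewrite -E -[RHS]Mx; apply: eq_bigr => l _; by rewrite mxE.
by rewrite !mxE.
Qed.

Lemma exists_ker_wide m (M : 'M[H]_(m, m.+1)) :
  exists2 v : 'cV[H]_m.+1, M *m v = 0 & v != 0.
Proof.
elim: m M => [|m IH] M.
  exists (const_mx 1); first by apply/matrixP => -[].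
  by apply/eqP => /matrixP /(_ 0 0); rewrite !mxE; apply/eqP/oner_neq0.
have [j0 j0P] : exists j0, M 0 j0 = 0 -> forall j, M 0 j = 0.
  have [/existsP[j Mj]|] := boolP [exists j, M 0 j != 0].
    by exists j => Mj0; rewrite Mj0 eqxx in Mj.
  by rewrite negb_exists => /forallP M0; exists 0 => _ j; apply/eqP/negPn.
set p := M 0 j0.
pose N := \matrix_(i, j) (M (lift 0 i) (lift j0 j)
                          - M (lift 0 i) j0 * (p^-1 * M 0 (lift j0 j))).
have [u Nu u0] := IH N.
pose s := \sum_j M 0 (lift j0 j) * u j 0.
pose v : 'cV[H]_m.+2 :=
  \col_j (if unlift j0 j is Some l then u l 0 else - (p^-1 * s)).
have ME i : (M *m v) i 0 =
    M i j0 * - (p^-1 * s) + \sum_j M i (lift j0 j) * u j 0.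
  rewrite mxE (bigD1_ord j0) //= mxE unlift_none; congr (_ + _).
  by apply: eq_bigr => j _; rewrite mxE liftK.
exists v.
  apply/matrixP => i j; rewrite (ord1 j) {j} ME mxE.
  case: (unliftP 0 i) => [l ->|->].
    have /matrixP/(_ l 0) := Nu; rewrite !mxE => NE; rewrite -[RHS]NE.
    rewrite mulrN mulrA /s mulr_sumr addrC -sumrN -big_split /=.
    apply: eq_bigr => j _.
    by rewrite !mxE mulrBl !mulrA.
  rewrite -/p -/s; have [p0|p0] := eqVneq p 0; last first.
    by rewrite mulrN mulrA (mulqV p0) mul1r addNr.
  by rewrite p0 mul0r add0r /s big1 // => j _; rewrite (j0P p0) mul0r.
apply: contra_neq u0 => v0; apply/matrixP => i j; rewrite (ord1 j).
by have /matrixP/(_ (lift j0 i) 0) := v0; rewrite !mxE liftK.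
Qed.

Lemma inj_is_invmx n (M : 'M[H]_n) :
  (forall v : 'cV[H]_n, M *m v = 0 -> v = 0) -> exists W, is_invmx M W.
Proof.
move=> Minj.
have Mker p (X : 'M[H]_(n, p)) : M *m X = 0 -> X = 0.
  move=> MX; apply/matrixP => i j.
  have /matrixP/(_ i 0) : col j X = 0.
    by apply: Minj; rewrite colE mulmxA MX mul0mx.
  by rewrite !mxE.
have surj (b : 'cV[H]_n) : exists x, M *m x = b.
  have [v] := exists_ker_wide (castmx (erefl, addn1 n) (row_mx M b)).
  move=> Mv v0; pose w := castmx (esym (addn1 n), erefl) v.
  have {}Mv : row_mx M b *m w = 0.
    by rewrite -[RHS]Mv /w; case: _ / (addn1 n) v {Mv v0 w} => v.
  have w0 : w != 0.
    by apply: contra_neq v0; rewrite /w; case: _ / (addn1 n) v {Mv w}.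
  move: Mv w0; rewrite -[w]vsubmxK; move: (usubmx w) (dsubmx w) => x y.
  rewrite mul_row_col => Mxy xy0.
  have y0 : y 0 0 != 0.
    apply: contra_neq xy0 => y0.
    have yE : y = 0 by apply/matrixP => i j; rewrite !ord1 y0 mxE.
    move: Mxy; rewrite yE mulmx0 addr0 => /Mker ->.
    by rewrite col_mx0.
  exists (- (x *m ((y 0 0)^-1)%:M)).
  rewrite mulmxN mulmxA; move/eqP: Mxy; rewrite addr_eq0 => /eqP ->.
  rewrite mulNmx opprK -mulmxA [y]mx11_scalar -scalar_mxM mxE eqxx mulr1n.
  by rewrite (mulqV y0) mulmx1.
have /choice[f fP] : forall j : 'I_n, exists x, M *m x = col j 1%:M.
  by move=> j; exact: surj.
exists (\matrix_(i, j) f j i 0).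
have MW : M *m (\matrix_(i, j) f j i 0) = 1%:M.
  apply/matrixP => i j; have /matrixP/(_ i 0) := fP j; rewrite !mxE => <-.
  by apply: eq_bigr => l _; rewrite mxE.
split=> //; apply/eqP; rewrite -subr_eq0; apply/eqP/Mker.
by rewrite mulmxBr mulmxA MW mul1mx mulmx1 subrr.
Qed.

Lemma ctrmx_mul m n p (M : 'M[H]_(m, n)) (N : 'M[H]_(n, p)) :
  ctrmx (M *m N) = ctrmx N *m ctrmx M.
Proof.
apply/matrixP => i j; rewrite !mxE conjq_sum; apply: eq_bigr => l _.
by rewrite !mxE conjqM.
Qed.

Lemma ctrmx_mul_eq0 n (w : 'cV[H]_n) : ctrmx w *m w = 0 -> w = 0.
Proof.
move=> /matrixP/(_ 0 0)/(congr1 (@qre R)); rewrite !mxE qre_sum => /eqP.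
have E i : qre (ctrmx w 0 i * w i 0) = normsq (w i 0).
  by rewrite !mxE conjq_mul.
rewrite (eq_bigr _ (fun i _ => E i)) psumr_eq0 => [/allP w0|i _]; last first.
  exact: normsq_ge0.
apply/matrixP => i j; rewrite ord1 mxE; apply/eqP; rewrite -normsq_eq0.
by apply: w0; rewrite mem_index_enum.
Qed.

(* Hence the default value of [qinvmx] never enters [pinvmxq M] here. *)
Lemma gram_is_invmx m n (M : 'M[H]_(m, n)) :
  full_col_rank M -> is_invmx (ctrmx M *m M) (qinvmx (ctrmx M *m M)).
Proof.
move=> /full_col_rankP Minj.
suff [W /qinvmxP //] : exists W, is_invmx (ctrmx M *m M) W.
apply: inj_is_invmx => v MMv; apply/Minj/ctrmx_mul_eq0.
by rewrite ctrmx_mul -mulmxA [ctrmx M *m _]mulmxA MMv mulmx0.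
Qed.

Lemma full_col_rank_col_mx m1 m2 n (M : 'M[H]_(m1, n)) (N : 'M[H]_(m2, n)) :
  full_col_rank M -> full_col_rank (col_mx M N).
Proof.
move=> /full_col_rankP Minj; apply/full_col_rankP => v.
rewrite mul_col_mx -[0]vsubmxK => /eq_col_mx[/[swap] _].
by rewrite linear0; exact: Minj.
Qed.

End QuaternionMatrix.

(* Main.v *)
Require Import Defs.
From mathcomp Require Import all_boot all_order all_algebra.
From mathcomp Require Import reals.

Import Order.TTheory GRing.Theory Num.Theory.
Local Open Scope ring_scope.

(** Since a = G c, we have a^* c = c^* G c = s^* s, a sum of squared norms, so
    d >= 1 is real.  With G_new = B_new^* B_new = G + a a^*, it suffices to check
    G_new X = B_new^* for the claimed pseudoinverse X: G_new c d^-1 =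
    a (1 + a^* c) d^-1 = a, and, as s^* = c^* B^* = a^* G^-1 B^*,
    G_new (G^-1 B^* - c d^-1 s^* ) = B^* + a s^* - a s^* = B^*. *)

Lemma conjqK (R : realType) : involutive (@conjq R).
Proof. by move=> x; apply: quatP; rewrite /= ?opprK. Qed.

Lemma realqD (R : realType) : {morph @realq R : x y / x + y}.
Proof. by move=> x y; apply: quatP; rewrite /= ?addr0. Qed.

Lemma ctrmxK (R : realType) m n (M : 'M[quat R]_(m, n)) :
  ctrmx (ctrmx M) = M.
Proof. by apply/matrixP => i j; rewrite !mxE conjqK. Qed.

Lemma ctrmx1 (R : realType) n : ctrmx (1%:M : 'M[quat R]_n) = 1%:M.
Proof.
apply/matrixP => i j; rewrite !mxE eq_sym.
by case: eqP => _; apply: quatP; rewrite /= ?oppr0.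
Qed.

Lemma ctrmx_col_mx (R : realType) m1 m2 n
    (M : 'M[quat R]_(m1, n)) (N : 'M[quat R]_(m2, n)) :
  ctrmx (col_mx M N) = row_mx (ctrmx M) (ctrmx N).
Proof. by rewrite /ctrmx map_col_mx tr_col_mx. Qed.

Lemma is_invmx_ctrmx (R : realType) n (M W : 'M[quat R]_n) :
  is_invmx M W -> is_invmx (ctrmx M) (ctrmx W).
Proof. by move=> [MW WM]; split; rewrite -ctrmx_mul ?MW ?WM ctrmx1. Qed.

Lemma ctrmx_mul_self_realq (R : realType) n (w : 'cV[quat R]_n) :
  (ctrmx w *m w) 0 0 = realq (\sum_i normsq (w i 0)).
Proof.
rewrite mxE (big_morph _ (@realqD R) (erefl : realq 0 = 0)).
by apply: eq_bigr => i _; rewrite !mxE conjq_mul.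
Qed.

(** Full column rank makes the Gram matrix invertible, so it cancels from the left of the normal
    equation. A candidate [X] can thus be checked without inverting the Gram matrix of [Bnew]. *)
Lemma pinvmxq_unique (R : realType) m n (M : 'M[quat R]_(m, n)) X :
  full_col_rank M -> ctrmx M *m M *m X = ctrmx M -> pinvmxq M = X.
Proof.
move=> /gram_is_invmx[_ WG] GX.
by rewrite /pinvmxq -[in X in _ *m X]GX mulmxA WG mul1mx.
Qed.

Theorem proposition4 (R : realType) (r k : nat)
    (B : 'M[quat R]_(r, k)) (a : 'cV[quat R]_k) :
  full_col_rank B ->
  let Bnew : 'M[quat R]_(r + 1, k) := col_mx B (ctrmx a) in
  let G : 'M[quat R]_k := ctrmx B *m B in
  let c : 'cV[quat R]_k := qinvmx G *m a in
  let d : quat R := 1 + (ctrmx a *m c) 0 0 in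
  let s : 'cV[quat R]_r := B *m c in
  (exists2 t : R, 0 < t & d = realq t) /\
  pinvmxq Bnew =
    row_mx (pinvmxq B - c *m (d^-1)%:M *m ctrmx s) (c *m (d^-1)%:M).
Proof.
move=> Bfull Bnew G c d s.
have Ginv : is_invmx G (qinvmx G) := gram_is_invmx Bfull.
have Gc : G *m c = a by rewrite mulmxA Ginv.1 mul1mx.
have Gstar : ctrmx G = G by rewrite ctrmx_mul ctrmxK.
(* Both sides are two-sided inverses of the Hermitian matrix [G]. *)
have Wstar : ctrmx (qinvmx G) = qinvmx G.
  by apply: (is_invmx_unique _ Ginv); rewrite -{1}Gstar; apply: is_invmx_ctrmx.
have ac : ctrmx a *m c = ctrmx s *m s.
  by rewrite -[in LHS]Gc !ctrmx_mul ctrmxK !mulmxA.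
have [t t_gt0 dE] : exists2 t : R, 0 < t & d = realq t.
  exists (1 + \sum_i normsq (s i 0)).
    rewrite ltr_pwDl ?ltr01 ?sumr_ge0 // => i _; exact: normsq_ge0.
  by rewrite /d ac ctrmx_mul_self_realq realqD.
split; first by exists t.
have d_neq0 : d != 0.
  by apply/eqP; rewrite dE => -[t0]; rewrite t0 ltxx in t_gt0.
have dM : 1%:M + ctrmx a *m c = d%:M.
  by rewrite [ctrmx a *m c]mx11_scalar -raddfD.
(* The factor [a] is pulled out on the left, as scalars do not commute: a + a (a^* c) = a d. *)
have Gnew_c : (G + a *m ctrmx a) *m (c *m (d^-1)%:M) = a.
  rewrite mulmxA mulmxDl Gc -mulmxA -{1}[a]mulmx1 -mulmxDr dM.
  by rewrite -mulmxA -scalar_mxM (mulqV d_neq0) mulmx1.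
apply: pinvmxq_unique; first exact: full_col_rank_col_mx.
(* The normal equation splits into two blocks; [Gnew_c] is the right one. *)
rewrite ctrmx_col_mx ctrmxK mul_row_col mul_mx_row Gnew_c; congr row_mx.
(* Reassociating lets [Gnew_c] also turn the correction term into a s^*. *)
rewrite mulmxBr [_ *m (_ *m ctrmx s)]mulmxA Gnew_c mulmxDl.
rewrite /pinvmxq mulmxA Ginv.1 mul1mx !ctrmx_mul Wstar !mulmxA.
by rewrite addrK.
Qed.
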